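(* There is a universal constant $c>0$ such that for every $s\ge1$ there is a group-floor instance with groups of size $s$, consisting of group floors $f_g$ and a fractional plan $x\ge0$ with $\sum_{i\in g}x_i\ge f_g$ for every group $g$, on which independent per-arm nearest-integer rounding $n_i=\mathrm{round}(x_i)$ violates some group floor by $\Omega(s)$: $\sum_{i\in g}n_i\le f_g-c\,s$ for some group $g$.
   Context: A group-floor instance has a finite set of arms, a collection of groups (subsets of arms), and for each group $g$ a floor $f_g\ge0$ requiring $\sum_{i\in g}n_i\ge f_g$ for an integral allocation $n$. Per-arm nearest-integer rounding replaces each $x_i$ by the integer nearest to it, independently of the group structure. *)

(* Defs.v *)
From HB Require Import structures.
From mathcomp Require Import all_boot all_order all_algebra.
From mathcomp Require Import reals.
From mathcomp Require Import lra.
Set Implicit Arguments.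
Unset Strict Implicit.
Unset Printing Implicit Defensive.
Import Order.TTheory GRing.Theory Num.Theory.
Local Open Scope ring_scope.

(* Floors are arbitrary nonnegative reals, not necessarily integers. *)
Record group_floor_instance (R : realType) := GroupFloorInstance {
  arm : finType;
  groups : {set {set arm}};
  group_floor : {set arm} -> R;
  group_floor_ge0 : forall g, g \in groups -> 0 <= group_floor g
}.

Definition groups_of_size (R : realType) (I : group_floor_instance R) (s : nat) :=
  forall g, g \in groups I -> #|g| = s.

Definition fractional_plan (R : realType) (I : group_floor_instance R)
    (x : arm I -> R) :=
  (forall i, 0 <= x i) /\
  (forall g, g \in groups I -> group_floor g <= \sum_(i in g) x i).

(* Ties at half-integers may be broken in any way. *)
Definition nearest_integer_rounding (R : realType) (round : R -> int) :=
  forall (y : R) (m : int), `|y - (round y)%:~R| <= `|y - m%:~R|.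

Lemma nearest_integer_rounding_floor (R : realType) :
  nearest_integer_rounding (fun y : R => Num.floor (y + 2^-1)).
Proof.
move=> y m; set n := Num.floor _.
have n_le : n%:~R <= y + 2^-1 by exact: Num.Theory.floor_le.
have lt_n : y + 2^-1 < n%:~R + 1.
  by rewrite -[1]/(1%:~R) -intrD; exact: Num.Theory.floorD1_gt.
have [lt_mn | lt_nm | -> //] := ltgtP m n.
- have le_mn : (m%:~R + 1 : R) <= n%:~R.
    by rewrite -[1]/(1%:~R) -intrD ler_int lezD1.
  rewrite [leRHS]ger0_norm; last lra.
  by rewrite ler_norml; apply/andP; split; lra.
- have le_nm : (n%:~R + 1 : R) <= m%:~R.
    by rewrite -[1]/(1%:~R) -intrD ler_int lezD1.
  rewrite [leRHS]ler0_norm; last lra.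
  by rewrite ler_norml; apply/andP; split; lra.
Qed.

(* Main.v *)
Require Import Defs.
From HB Require Import structures.
From mathcomp Require Import all_boot all_order all_algebra.
From mathcomp Require Import reals.
From mathcomp Require Import lra.
Import Order.TTheory GRing.Theory Num.Theory.
Local Open Scope ring_scope.

(* A single group of s arms, each planned at 1/3, meets the floor s/3 exactly,
   but every arm is rounded down to 0, so the whole floor is lost. *)

(** Each arm loses 1/3, and since rounding ignores the group, the losses all have the same sign and
    add up to s/3, so [c] = 1/3 works. As 1/3 is not a half-integer,
    [nearest_integer_rounding_third] holds under every tie-breaking rule. *)

Lemma nearest_integer_rounding_third (R : realType) (round : R -> int) :
  nearest_integer_rounding round -> round 3^-1 = 0.
Proof.
(* Comparing with the candidate integer 0 puts [round 3^-1] between 0 and 2/3; integrality does the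
   rest. *)
move=> /(_ 3^-1 0); rewrite subr0 [leRHS]ger0_norm ?invr_ge0 ?ler0n //.
rewrite ler_norml => /andP[lo hi].
have r_ge0 : 0 <= round 3^-1 by rewrite -(ler0z R); lra.
have r_lt1 : round 3^-1 < 1 by rewrite -(ltrz1 R); lra.
by apply/eqP; rewrite eq_le r_ge0 andbT -ltzD1 add0r.
Qed.

Lemma third_floor_ge0 (R : realType) (s : nat) (g : {set 'I_s}) :
  g \in [set [set: 'I_s]] -> 0 <= s%:R / 3 :> R.
Proof. by move=> _; rewrite divr_ge0 ?ler0n. Qed.

Theorem proposition5 (R : realType) :
  exists c : R, 0 < c /\
    forall s : nat, (1 <= s)%N ->
      exists (I : group_floor_instance R) (x : arm I -> R),
        [/\ groups_of_size I s,
            fractional_plan x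
          & forall round : R -> int, nearest_integer_rounding round ->
              exists g : {set arm I}, g \in groups I /\
                \sum_(i in g) (round (x i))%:~R <= group_floor g - c * s%:R].
Proof.
exists 3^-1; split=> [|s _]; first by rewrite invr_gt0 ltr0n.
exists (GroupFloorInstance (@third_floor_ge0 R s)), (fun=> 3^-1); split=> /=.
- by move=> g /set1P ->; rewrite cardsT card_ord.
- split=> [i|g /set1P ->] /=; first by rewrite invr_ge0 ler0n.
  by rewrite sumr_const cardsT card_ord mulr_natl.
- move=> round /nearest_integer_rounding_third r0.
  exists [set: 'I_s]; split; first exact: set11.
  (* Both sides are 0: the floor s/3 equals [c * s], so the bound is attained. *)
  by rewrite big1 => [|i _]; rewrite ?r0 // mulrC subrr.
Qed.
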